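(* For fixed value of $\lambda\in\mathbb{R}$, a parametrization of the touching curve $\mathcal{C}_\lambda$ between $\mathcal{O}$ and $\mathcal{Q}_\lambda$ is given by $$\gamma(\lambda,\cdot):\ I_1\cup I_2\to\mathbb{R}^3,\qquad \gamma(\lambda,t)=\begin{cases}\gamma_1(\lambda,t)&\text{if } t\in I_1,\\ \gamma_2(\lambda,t)&\text{if } t\in I_2,\end{cases}$$ (values of $t$ at which the denominators below vanish being excluded) with $I_1=\left[-\frac{2\pi}3,\frac{2\pi}3\right]$, $I_2=\left(\frac{2\pi}3,2\pi\right]$, $$\gamma_1(\lambda,t)=\big(\kappa_1(\lambda,t),\kappa_2(\lambda,t),\kappa_3(\lambda,t)\big),$$ $$\gamma_2(\lambda,t)=\left(\kappa_1\!\left(\lambda,\tfrac{4\pi}3-t\right),\ \kappa_2\!\left(\lambda,\tfrac{4\pi}3-t\right),\ -\kappa_3\!\left(\lambda,\tfrac{4\pi}3-t\right)\right),$$ where $$\kappa_1(\lambda,t)=\frac{(1-\lambda)\sin t}{1+\lambda\cos t},\quad \kappa_2(\lambda,t)=\frac{2\lambda-1+(\lambda-2)\cos t}{2(1+\lambda\cos t)},\quad \kappa_3(\lambda,t)=\frac{\lambda\sqrt{1+2\cos t}}{1+\lambda\cos t}.$$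
   Context: Let $k_A=\{(x,y,z)\in\mathbb{R}^3: x^2+(y+\frac12)^2=1,\ z=0\}$ and $k_B=\{(x,y,z)\in\mathbb{R}^3: (y-\frac12)^2+z^2=1,\ x=0\}$. The extended oloid $\mathcal{O}$ is the developable surface containing the surface of the convex hull of $k_A\cup k_B$; it is the union of the generating lines $x=\omega_1(m,t)$, $y=\omega_2(m,t)$, $z=\pm\omega_3(m,t)$, $m\in\mathbb{R}$, for $t\in[-\frac{2\pi}3,\frac{2\pi}3]$, where $$\omega_1=(1-m)\sin t,\quad \omega_2=(1-m)\left(-\tfrac12-\cos t\right)+m\left(\tfrac12-\tfrac{\cos t}{1+\cos t}\right),\quad \omega_3=\frac{m\sqrt{1+2\cos t}}{1+\cos t}.$$ Along each generating line the tangent plane of $\mathcal{O}$ is constant; it is tangent to $k_A$ and to $k_B$. The inscribed quadrics of $\mathcal{O}$ are $\mathcal{Q}_\lambda=\{(x,y,z)\in\mathbb{R}^3: f_\lambda(x,y,z)=0\}$ with $$f_\lambda(x,y,z)=\frac{x^2}{1-\lambda}+\frac{(y-\lambda+\frac12)^2}{1-\lambda+\lambda^2}+\frac{z^2}{\lambda}-1,$$ with the convention $\mathcal{Q}_0=k_A$, $\mathcal{Q}_1=k_B$ for the degenerate cases. Every tangent plane of $\mathcal{O}$ is tangent to every $\mathcal{Q}_\lambda$. The touching curve $\mathcal{C}_\lambda$ is the curve along which $\mathcal{O}$ and $\mathcal{Q}_\lambda$ touch: it consists of the contact points of the generating lines of $\mathcal{O}$ with $\mathcal{Q}_\lambda$,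 i.e. of the points on generating lines at which the tangent plane of $\mathcal{O}$ along the line is tangent to $\mathcal{Q}_\lambda$ (for a circle: contains the tangent line of the circle at that point). *)

(* Defs.v *)
From Stdlib Require Export Reals.
From Coquelicot Require Export Coquelicot.
Open Scope R_scope.

Definition R3 : Type := (R * R * R)%type.

Definition vec (x y z : R) : R3 := (x, y, z).
Definition px (p : R3) : R := fst (fst p).
Definition py (p : R3) : R := snd (fst p).
Definition pz (p : R3) : R := snd p.

Definition vadd (p q : R3) : R3 := vec (px p + px q) (py p + py q) (pz p + pz q).
Definition vsub (p q : R3) : R3 := vec (px p - px q) (py p - py q) (pz p - pz q).
Definition vscal (a : R) (p : R3) : R3 := vec (a * px p) (a * py p) (a * pz p).
Definition dot (p q : R3) : R := px p * px q + py p * py q + pz p * pz q.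

Definition plane (p n : R3) (v : R3) : Prop := dot n (vsub v p) = 0.

Definition kA (p : R3) : Prop := (px p)^2 + (py p + 1/2)^2 = 1 /\ pz p = 0.
Definition kB (p : R3) : Prop := (py p - 1/2)^2 + (pz p)^2 = 1 /\ px p = 0.

(* The direction of the tangent line at p is the radius vector of p turned by
   a right angle inside the plane of the circle. *)
Definition tangent_line_kA (p v : R3) : Prop :=
  exists r : R, v = vadd p (vscal r (vec (- (py p + 1/2)) (px p) 0)).
Definition tangent_line_kB (p v : R3) : Prop :=
  exists r : R, v = vadd p (vscal r (vec 0 (- pz p) (py p - 1/2))).

Definition I1 (t : R) : Prop := - (2 * PI / 3) <= t <= 2 * PI / 3.
Definition I2 (t : R) : Prop := 2 * PI / 3 < t <= 2 * PI.

Definition omega1 (m t : R) : R := (1 - m) * sin t.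
Definition omega2 (m t : R) : R :=
  (1 - m) * (- (1/2) - cos t) + m * (1/2 - cos t / (1 + cos t)).
Definition omega3 (m t : R) : R := m * sqrt (1 + 2 * cos t) / (1 + cos t).

(* s is the sign (1 or -1) in front of omega3. *)
Definition is_sign (s : R) : Prop := s = 1 \/ s = -1.
Definition omega (s m t : R) : R3 := vec (omega1 m t) (omega2 m t) (s * omega3 m t).

Definition generating_line (s t : R) (p : R3) : Prop :=
  exists m : R, p = omega s m t.

Definition omega_dm (s m t : R) : R3 :=
  vec (Derive (fun u => omega1 u t) m)
      (Derive (fun u => omega2 u t) m)
      (s * Derive (fun u => omega3 u t) m).
Definition omega_dt (s m t : R) : R3 :=
  vec (Derive (fun u => omega1 m u) t)
      (Derive (fun u => omega2 m u) t)
      (s * Derive (fun u => omega3 m u) t).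

(* A continuous nowhere zero field of surface normals, constant along each
   generating line.  Orthogonality to the partial derivatives is required for
   |t| < 2 pi / 3 only, since omega3 has no t-derivative at t = +-2 pi / 3,
   where the sheets s = 1 and s = -1 meet; there the normal direction is given
   by continuity. *)
Definition normal_field (s : R) (N : R -> R3) : Prop :=
  continuous_on I1 N /\
  (forall t, I1 t -> N t <> vec 0 0 0) /\
  (forall t m, - (2 * PI / 3) < t < 2 * PI / 3 ->
     dot (N t) (omega_dm s m t) = 0 /\ dot (N t) (omega_dt s m t) = 0).

Definition oloid_tangent_plane (s t : R) (P : R3 -> Prop) : Prop :=
  exists N : R -> R3, normal_field s N /\
    forall v, P v <-> plane (omega s 0 t) (N t) v.

Definition f_quad (lam x y z : R) : R :=
  x^2 / (1 - lam) + (y - lam + 1/2)^2 / (1 - lam + lam^2) + z^2 / lam - 1.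

Definition grad_f (lam : R) (p : R3) : R3 :=
  vec (Derive (fun x => f_quad lam x (py p) (pz p)) (px p))
      (Derive (fun y => f_quad lam (px p) y (pz p)) (py p))
      (Derive (fun z => f_quad lam (px p) (py p) z) (pz p)).

Definition quadric (lam : R) (p : R3) : Prop :=
  if Req_EM_T lam 0 then kA p
  else if Req_EM_T lam 1 then kB p
  else f_quad lam (px p) (py p) (pz p) = 0.

(* The plane P is tangent to the quadric with parameter lam at its point p. *)
Definition tangent_to_quadric (lam : R) (P : R3 -> Prop) (p : R3) : Prop :=
  quadric lam p /\
  if Req_EM_T lam 0 then forall v, tangent_line_kA p v -> P v
  else if Req_EM_T lam 1 then forall v, tangent_line_kB p v -> P v
  else forall v, P v <-> plane p (grad_f lam p) v.

Definition touching_curve (lam : R) (p : R3) : Prop :=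
  exists (s t : R) (P : R3 -> Prop),
    is_sign s /\ I1 t /\ generating_line s t p /\
    oloid_tangent_plane s t P /\ tangent_to_quadric lam P p.

Definition kappa1 (lam t : R) : R := (1 - lam) * sin t / (1 + lam * cos t).
Definition kappa2 (lam t : R) : R :=
  (2 * lam - 1 + (lam - 2) * cos t) / (2 * (1 + lam * cos t)).
Definition kappa3 (lam t : R) : R :=
  lam * sqrt (1 + 2 * cos t) / (1 + lam * cos t).

Definition gamma1 (lam t : R) : R3 :=
  vec (kappa1 lam t) (kappa2 lam t) (kappa3 lam t).
Definition gamma2 (lam t : R) : R3 :=
  vec (kappa1 lam (4 * PI / 3 - t)) (kappa2 lam (4 * PI / 3 - t))
      (- kappa3 lam (4 * PI / 3 - t)).

(* On the union of I1 and I2, the test t <= 2 pi / 3 is membership in I1. *)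
Definition gamma (lam t : R) : R3 :=
  if Rle_dec t (2 * PI / 3) then gamma1 lam t else gamma2 lam t.

Definition gamma_dom (lam t : R) : Prop :=
  (I1 t /\ 1 + lam * cos t <> 0) \/
  (I2 t /\ 1 + lam * cos (4 * PI / 3 - t) <> 0).

(* g, restricted to D, is a continuous map with image C. *)
Definition parametrizes (D : R -> Prop) (g : R -> R3) (C : R3 -> Prop) : Prop :=
  continuous_on D g /\ forall p, C p <-> exists t, D t /\ g t = p.

(* Main.v *)
Require Import Defs.
From Stdlib Require Import Lra Psatz.

(** The generating lines of the sheet [z = s * omega3] carry the explicit normal
    [oloid_normal s t = (sin t, - cos t, s * sqrt (1 + 2 cos t))]: the plane
    through the point [omega s 0 t] of the first circle with this normal also
    touches the second circle ([oloid_normal_field]).  For |t| < 2 pi / 3 the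
    surface has two independent tangent vectors, so every normal field is
    proportional to this one, and continuity carries this over to the two end
    values of t ([normal_field_unique]).  Hence [oloid_tangent_plane s t P]
    determines the plane P.

    With [n = oloid_normal s t], [a = (1 - lam, 1 - lam + lam^2, lam)] the squared
    semi-axes, [c0] the centre of the quadric and [h = 1 + lam cos t], the plane is
    [n . (v - c0) = h], and the identity behind everything is
    [a1 n1^2 + a2 n2^2 + a3 n3^2 = h^2] ([dual_quadric]): the plane satisfies the
    equation of the dual quadric, which says that it is tangent to the quadric.
    If p is a point of contact, the gradient of the quadric at p is parallel
    to n, so [p - c0 = mu (a1 n1, a2 n2, a3 n3)] for some mu.  The equation of
    the quadric becomes [mu^2 h^2 = 1], so that h cannot vanish, and
    the equation of the plane becomes [mu h^2 = h], so that mu = 1 / h.  Written out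
    this is the point [(kappa1, kappa2, s * kappa3)].  For the two circles (lam = 0
    and lam = 1) a point of the circle in a tangent plane is found instead from
    the equality case of Cauchy's inequality ([unit_dot_eq]).

    So the touching curve is the union over s of the arcs
    [(kappa1, kappa2, s * kappa3)]; both arcs end at the same points with
    [kappa3 = 0], and gamma runs through the second arc backwards after the
    first one. *)

(** * Vectors of R3 *)

Lemma R3_eq (p q : R3) : px p = px q -> py p = py q -> pz p = pz q -> p = q.
Proof.
  destruct p as [[a b] c], q as [[a' b'] c']; unfold px, py, pz; simpl.
  intros -> -> ->; reflexivity.
Qed.

Lemma px_vec x y z : px (vec x y z) = x. Proof. reflexivity. Qed.
Lemma py_vec x y z : py (vec x y z) = y. Proof. reflexivity. Qed.
Lemma pz_vec x y z : pz (vec x y z) = z. Proof. reflexivity. Qed.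

Ltac vsimp :=
  unfold plane, dot, vsub, vadd, vscal in *;
  repeat rewrite ?px_vec, ?py_vec, ?pz_vec in *.

Definition parallel (u v : R3) : Prop :=
  px u * py v = py u * px v /\ px u * pz v = pz u * px v /\
  py u * pz v = pz u * py v.

Lemma parallel_scal (u n : R3) :
  n <> vec 0 0 0 -> parallel u n -> exists k, u = vscal k n.
Proof.
  intros Hn (H1 & H2 & H3).
  set (d := px n ^ 2 + py n ^ 2 + pz n ^ 2).
  assert (Hd : d <> 0) by (intros H; apply Hn, R3_eq; unfold d in H; vsimp; nra).
  (* The coefficient of the orthogonal projection of u to the line of n. *)
  exists (dot u n / d).
  assert (K : forall x y, x * d = dot u n * y -> x = dot u n / d * y).
  { intros x y E; apply (Rmult_eq_reg_r d); [rewrite E; field|]; exact Hd. }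
  apply R3_eq; vsimp; apply K; unfold d.
  - transitivity (px u * px n * px n + px u * py n * py n + px u * pz n * pz n);
      [ring | rewrite H1, H2; ring].
  - transitivity (py u * px n * px n + py u * py n * py n + py u * pz n * pz n);
      [ring | rewrite <- H1, H3; ring].
  - transitivity (pz u * px n * px n + pz u * py n * py n + pz u * pz n * pz n);
      [ring | rewrite <- H2, <- H3; ring].
Qed.

Lemma plane_scal (p n v : R3) (k : R) :
  k <> 0 -> plane p (vscal k n) v <-> plane p n v.
Proof.
  intros Hk; vsimp.
  replace (k * px n * (px v - px p) + k * py n * (py v - py p)
           + k * pz n * (pz v - pz p))
    with (k * (px n * (px v - px p) + py n * (py v - py p)
               + pz n * (pz v - pz p))) by ring.
  split; intros H; [nra | rewrite H; ring].
Qed.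

Lemma plane_move (p q n v : R3) : plane p n q -> plane q n v <-> plane p n v.
Proof. vsimp; split; intros; nra. Qed.

(** A plane determines the directions it contains, and these determine its normal
    up to a factor. *)
Lemma same_plane_parallel (p q n g : R3) :
  (forall v, plane q n v <-> plane p g v) -> parallel g n.
Proof.
  intros H.
  assert (Hp : plane q n p) by (apply H; vsimp; ring).
  assert (K : forall w, dot n w = 0 -> dot g w = 0).
  { intros w Hw. specialize (proj1 (H (vadd p w))); intros K.
    vsimp; lapply K; [intros E|]; nra. }
  (* The three directions are the cross products of n with the axes. *)
  pose proof (K (vec (py n) (- px n) 0)) as K1.
  pose proof (K (vec (pz n) 0 (- px n))) as K2.
  pose proof (K (vec 0 (pz n) (- py n))) as K3.
  vsimp; repeat split; nra.
Qed.

(** Equality case of Cauchy's inequality: the squared distance of the two unit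
    vectors is twice the defect 1 - (a u + b v). *)
Lemma unit_dot_eq (a b u v : R) :
  a ^ 2 + b ^ 2 = 1 -> u ^ 2 + v ^ 2 = 1 -> a * u + b * v = 1 -> a = u /\ b = v.
Proof.
  intros H1 H2 H3.
  pose proof (pow2_ge_0 (a - u)); pose proof (pow2_ge_0 (b - v)).
  split; apply Rminus_diag_uniq, Rsqr_0_uniq; unfold Rsqr; nra.
Qed.

(** * The cosine on the parameter interval *)

Lemma cos_2PI3' : cos (2 * PI / 3) = - (1 / 2).
Proof. replace (2 * PI / 3) with (2 * (PI / 3)) by field. rewrite cos_2PI3; lra. Qed.

Lemma I1_cos t : I1 t -> - (1 / 2) <= cos t.
Proof.
  pose proof PI_RGT_0. unfold I1; intros Ht; rewrite <- cos_2PI3'.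
  destruct (Rle_dec 0 t).
  - apply cos_decr_1; lra.
  - rewrite <- (cos_neg t); apply cos_decr_1; lra.
Qed.

Lemma interior_cos t : - (2 * PI / 3) < t < 2 * PI / 3 -> - (1 / 2) < cos t.
Proof.
  pose proof PI_RGT_0. intros Ht; rewrite <- cos_2PI3'.
  destruct (Rle_dec 0 t).
  - apply cos_decreasing_1; lra.
  - rewrite <- (cos_neg t); apply cos_decreasing_1; lra.
Qed.

Lemma sin_cos_sq t : sin t ^ 2 = 1 - cos t ^ 2.
Proof. pose proof (sin2_cos2 t); unfold Rsqr in *; nra. Qed.

Lemma sqrt_cos_sq t : I1 t -> sqrt (1 + 2 * cos t) ^ 2 = 1 + 2 * cos t.
Proof. intros Ht; apply I1_cos in Ht; apply pow2_sqrt; lra. Qed.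

Lemma is_sign_sq s : is_sign s -> s ^ 2 = 1.
Proof. intros [-> | ->]; ring. Qed.

(** * The tangent planes of the oloid *)

Definition oloid_normal (s t : R) : R3 :=
  vec (sin t) (- cos t) (s * sqrt (1 + 2 * cos t)).

Lemma oloid_normal_neq0 s t : oloid_normal s t <> vec 0 0 0.
Proof.
  intros H. pose proof (sin_cos_sq t) as E.
  assert (H1 := f_equal px H); assert (H2 := f_equal py H).
  unfold oloid_normal in *; vsimp; nra.
Qed.

(** Both circles touch the plane with normal [oloid_normal s t] at the points
    [m = 0] and [m = 1] of the line, hence it contains the whole line. *)
Lemma line_in_plane s t m :
  is_sign s -> I1 t ->
  plane (omega s 0 t) (oloid_normal s t) (omega s m t).
Proof.
  intros Hs Ht. pose proof (I1_cos t Ht).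
  pose proof (sqrt_cos_sq t Ht) as Hq. pose proof (is_sign_sq s Hs) as Hs2.
  pose proof (sin_cos_sq t) as HS.
  unfold oloid_normal, omega; vsimp; unfold omega1, omega2, omega3.
  set (c := cos t) in *; set (S := sin t) in *; set (q := sqrt (1 + 2 * c)) in *.
  field_simplify_eq; [|lra].
  replace (S ^ 2) with (1 - c ^ 2) by lra.
  replace (s ^ 2) with 1 by lra.
  replace (q ^ 2) with (1 + 2 * c) by lra. ring.
Qed.

Lemma omega_dm_E s m t :
  omega_dm s m t = vsub (omega s 1 t) (omega s 0 t).
Proof.
  unfold omega_dm, omega; apply R3_eq; vsimp;
    unfold omega1, omega2, omega3, Rdiv.
  - apply is_derive_unique; auto_derive; [auto|ring].
  - apply is_derive_unique; auto_derive; [auto|ring].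
  - rewrite (is_derive_unique _ _ (sqrt (1 + 2 * cos t) * / (1 + cos t))); [ring|].
    auto_derive; [auto|ring].
Qed.

Lemma omega_dt_E s m t :
  - (2 * PI / 3) < t < 2 * PI / 3 ->
  omega_dt s m t =
  vec ((1 - m) * cos t)
      ((1 - m) * sin t + m * (sin t / (1 + cos t) ^ 2))
      (s * (m * (sqrt (1 + 2 * cos t) * sin t / (1 + cos t) ^ 2
                 - sin t / (sqrt (1 + 2 * cos t) * (1 + cos t))))).
Proof.
  intros Ht; apply interior_cos in Ht.
  assert (0 < sqrt (1 + 2 * cos t)) by (apply sqrt_lt_R0; lra).
  unfold omega_dt; apply R3_eq; vsimp; unfold omega1, omega2, omega3.
  - apply is_derive_unique; auto_derive; [auto|ring].
  - apply is_derive_unique; auto_derive; [lra|field; lra].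
  - f_equal; apply is_derive_unique; auto_derive; [lra|field; lra].
Qed.

Lemma continuous_pair {U V : UniformSpace} (f : R -> U) (g : R -> V) t :
  continuous f t -> continuous g t -> continuous (fun u => (f u, g u)) t.
Proof.
  intros Hf Hg; apply (continuous_comp_2 f g (fun x y => (x, y))); auto.
  apply (continuous_ext (fun z => z)); [intros []; reflexivity|].
  apply continuous_id.
Qed.

Lemma continuous_R3 (f g h : R -> R) t :
  continuous f t -> continuous g t -> continuous h t ->
  continuous (fun u => vec (f u) (g u) (h u)) t.
Proof.
  intros; apply (continuous_pair (fun u => (f u, g u)) h); [|assumption].
  apply (continuous_pair f g); assumption.
Qed.

Lemma oloid_normal_field s : is_sign s -> normal_field s (oloid_normal s).
Proof.
  intros Hs; split; [|split].
  - apply continuous_on_forall; intros t _; unfold oloid_normal; apply continuous_R3.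
    + apply continuous_sin.
    + apply (continuous_opp (V := R_NormedModule)), continuous_cos.
    + apply (continuous_mult (K := R_AbsRing)); [apply continuous_const|].
      apply continuous_sqrt_comp.
      apply (ex_derive_continuous (fun u => 1 + 2 * cos u)); auto_derive; auto.
  - intros t _; apply oloid_normal_neq0.
  - intros t m Ht; split.
    + rewrite omega_dm_E.
      apply (line_in_plane s t 1 Hs); unfold I1; lra.
    + rewrite (omega_dt_E s m t Ht).
      pose proof (sqrt_cos_sq t ltac:(unfold I1; lra)) as Hq.
      pose proof (is_sign_sq s Hs) as Hs2.
      apply interior_cos in Ht.
      assert (Hq0 : 0 < sqrt (1 + 2 * cos t)) by (apply sqrt_lt_R0; lra).
      unfold oloid_normal; vsimp.
      set (c := cos t) in *; set (S := sin t) in *.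
      set (q := sqrt (1 + 2 * c)) in *.
      field_simplify_eq; [|lra].
      replace (s ^ 2) with 1 by lra.
      replace (q ^ 2) with (1 + 2 * c) by lra. ring.
Qed.

(** Shrinking t towards 0 stays in the interval and moves t by little. *)
Lemma interior_dense t (P : R -> Prop) :
  I1 t -> locally t P -> exists u, - (2 * PI / 3) < u < 2 * PI / 3 /\ P u.
Proof.
  intros Ht [eps He]; unfold I1 in Ht.
  pose proof PI_RGT_0. pose proof PI_4.
  pose proof (cond_pos eps).
  set (d := Rmin (1 / 2) (eps / 4)).
  assert (0 < d <= 1 / 2 /\ d <= eps / 4) as [Hd1 Hd2].
  { unfold d, Rmin; destruct Rle_dec; lra. }
  exists (t * (1 - d)); split; [nra|].
  (* |t| <= 2 pi / 3 <= 8 / 3, so the shift t * d stays below eps. *)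
  apply He; change (Rabs (t * (1 - d) - t) < eps).
  apply Rabs_def1; nra.
Qed.

Lemma eq_on_closure (f g : R -> R) :
  continuous_on I1 f -> continuous_on I1 g ->
  (forall t, - (2 * PI / 3) < t < 2 * PI / 3 -> f t = g t) ->
  forall t, I1 t -> f t = g t.
Proof.
  intros Hf Hg E t Ht.
  set (D := fun u => - (2 * PI / 3) < u < 2 * PI / 3).
  assert (PF : ProperFilter' (within D (locally t))).
  { split; [|apply within_filter, locally_filter].
    intros H; destruct (interior_dense t _ Ht H) as (u & Hu & []); exact Hu. }
  assert (L : forall h : R -> R, continuous_on I1 h ->
              filterlim h (within D (locally t)) (locally (h t))).
  { intros h Hh P HP; specialize (Hh t Ht P HP).
    unfold filtermap, within in *; revert Hh; apply filter_imp.
    intros u Hu Du; apply Hu; unfold D, I1 in *; lra. }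
  apply (filterlim_locally_unique (F := within D (locally t)) f); [auto|].
  apply (filterlim_ext_loc g); [|auto].
  unfold within; apply filter_forall; intros u Du; symmetry; apply E, Du.
Qed.

Lemma continuous_on_coords (D : R -> Prop) (N : R -> R3) :
  continuous_on D N ->
  continuous_on D (fun t => px (N t)) /\ continuous_on D (fun t => py (N t)) /\
  continuous_on D (fun t => pz (N t)).
Proof.
  intros H; repeat split; intros t Ht; specialize (H t Ht).
  - apply (filterlim_comp _ _ _ N px _ _ _ H).
    apply (filterlim_comp _ _ _ fst fst _ (locally (fst (N t))));
      destruct (N t) as [[x y] z]; apply continuous_fst.
  - apply (filterlim_comp _ _ _ N py _ _ _ H).
    apply (filterlim_comp _ _ _ fst snd _ (locally (fst (N t))));
      destruct (N t) as [[x y] z]; [apply continuous_fst | apply continuous_snd].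
  - apply (filterlim_comp _ _ _ N pz _ _ _ H).
    destruct (N t) as [[x y] z]; apply continuous_snd.
Qed.

Lemma continuous_on_mult (D : R -> Prop) (f g : R -> R) :
  continuous_on D f -> continuous_on D g -> continuous_on D (fun t => f t * g t).
Proof.
  intros Hf Hg t Ht.
  apply (filterlim_comp_2 f g Rmult (Hf t Ht) (Hg t Ht)).
  apply (filterlim_mult (K := R_AbsRing)).
Qed.

(** For |t| < 2 pi / 3 the line direction and the tangent of the first circle are
    two independent tangent vectors, the former being the only one to leave the
    plane of that circle; at the end values of t the line lies in that plane too,
    and only continuity determines the normal. *)
Lemma normal_field_unique s t N :
  is_sign s -> normal_field s N -> I1 t -> parallel (N t) (oloid_normal s t).
Proof.
  intros Hs (HC & HN & HO).
  assert (I : forall u, - (2 * PI / 3) < u < 2 * PI / 3 ->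
              parallel (N u) (oloid_normal s u)).
  { intros u Hu; destruct (HO u 0 Hu) as [H1 H2].
    rewrite omega_dm_E in H1; rewrite omega_dt_E in H2 by exact Hu.
    pose proof (sqrt_cos_sq u ltac:(unfold I1; lra)) as Hq.
    apply interior_cos in Hu.
    pose proof (is_sign_sq s Hs) as Hs2.
    assert (Hq0 : 0 < sqrt (1 + 2 * cos u)) by (apply sqrt_lt_R0; lra).
    pose proof (sin_cos_sq u) as HS.
    unfold oloid_normal, omega, parallel in *; vsimp; unfold omega1, omega2, omega3 in *.
    set (c := cos u) in *; set (S := sin u) in *; set (q := sqrt (1 + 2 * c)) in *.
    set (a := px (N u)) in *; set (b := py (N u)) in *; set (d := pz (N u)) in *.
    (* H2 leaves the multiples of (S, - c) for the first two coordinates. *)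
    set (k := a * S - b * c).
    assert (H2' : a * c + b * S = 0) by lra.
    assert (Ea : a = k * S).
    { transitivity (a * S ^ 2 + c * (a * c)); [rewrite HS; ring|].
      replace (a * c) with (- (b * S)) by lra; unfold k; ring. }
    assert (Eb : b = - k * c).
    { transitivity (b * c ^ 2 + S * (b * S)); [ring_simplify; rewrite HS; ring|].
      replace (b * S) with (- (a * c)) by lra; unfold k; ring. }
    assert (Ed : d = k * (s * q)).
    { clearbody k; rewrite Ea, Eb in H1.
      assert (E : d * s * q = k * q ^ 2).
      { rewrite Hq.
        transitivity ((1 + c) * (k * S ^ 2 + k * c * (1 + c)) - k * c ^ 2);
          [|rewrite HS; ring].
        apply Rminus_diag_uniq, (Rmult_eq_reg_r (/ (1 + c)));
          [|apply Rinv_neq_0_compat; lra].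
        rewrite Rmult_0_l, <- H1; field; lra. }
      apply (Rmult_eq_reg_r q); [|lra].
      transitivity (s * (d * s * q)); [|rewrite E; ring].
      transitivity (s ^ 2 * (d * q)); [rewrite Hs2|]; ring. }
    clearbody k; rewrite Ea, Eb, Ed; repeat split; ring. }
  destruct (continuous_on_coords _ _ HC) as (C1 & C2 & C3).
  destruct (continuous_on_coords _ _ (proj1 (oloid_normal_field s Hs)))
    as (D1 & D2 & D3).
  intros Ht; repeat split; revert t Ht; apply eq_on_closure;
    try (apply continuous_on_mult; assumption); intros u Hu; apply I, Hu.
Qed.

Lemma oloid_tangent_plane_iff s t P :
  is_sign s -> I1 t ->
  oloid_tangent_plane s t P <->
  (forall v, P v <-> plane (omega s 0 t) (oloid_normal s t) v).
Proof.
  intros Hs Ht; split.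
  - intros (N & HN & HP) v; rewrite HP.
    destruct (parallel_scal (N t) (oloid_normal s t)) as [k Hk].
    + apply oloid_normal_neq0.
    + apply normal_field_unique; assumption.
    + rewrite Hk; apply plane_scal; intros ->.
      apply (proj1 (proj2 HN) t Ht); rewrite Hk; apply R3_eq; vsimp; ring.
  - intros HP; exists (oloid_normal s); split; [apply oloid_normal_field|]; assumption.
Qed.

(** * Contact with the quadrics *)

Definition contact_point (s lam t : R) : R3 :=
  vec (kappa1 lam t) (kappa2 lam t) (s * kappa3 lam t).

Lemma contact_point_on_line s lam t :
  I1 t -> 1 + lam * cos t <> 0 ->
  contact_point s lam t = omega s (lam * (1 + cos t) / (1 + lam * cos t)) t.
Proof.
  intros Ht Hh; apply I1_cos in Ht.
  unfold contact_point, omega, omega1, omega2, omega3, kappa1, kappa2, kappa3.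
  apply R3_eq; vsimp; field; lra.
Qed.

Lemma dual_quadric s t lam :
  is_sign s -> I1 t ->
  (1 - lam) * sin t ^ 2 + (1 - lam + lam ^ 2) * cos t ^ 2
  + lam * (s * sqrt (1 + 2 * cos t)) ^ 2 = (1 + lam * cos t) ^ 2.
Proof.
  intros Hs Ht.
  rewrite sin_cos_sq, Rpow_mult_distr, (sqrt_cos_sq t Ht), (is_sign_sq s Hs); ring.
Qed.

Lemma grad_f_E lam p :
  grad_f lam p = vec (2 * (px p / (1 - lam)))
                     (2 * ((py p - lam + 1 / 2) / (1 - lam + lam ^ 2)))
                     (2 * (pz p / lam)).
Proof.
  unfold grad_f, f_quad, Rdiv; apply R3_eq; vsimp;
    apply is_derive_unique; auto_derive; auto; simpl; ring.
Qed.

(** The plane touches the quadric in at most one point; its position is found by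
    solving for p - c0 in the condition that the gradient is parallel to the normal.
    If 1 + lam cos t = 0, the plane passes through the centre of the quadric and is
    tangent to its asymptotic cone, so that the contact is at infinity. *)
Lemma contact_point_proper s t lam p :
  is_sign s -> I1 t -> lam <> 0 -> lam <> 1 ->
  (f_quad lam (px p) (py p) (pz p) = 0 /\
   forall v, plane (omega s 0 t) (oloid_normal s t) v <-> plane p (grad_f lam p) v)
  <-> 1 + lam * cos t <> 0 /\ p = contact_point s lam t.
Proof.
  intros Hs Ht H0 H1.
  assert (H2 : 0 < 1 - lam + lam ^ 2) by (pose proof (pow2_ge_0 (lam - 1 / 2)); nra).
  pose proof (dual_quadric s t lam Hs Ht) as HD.
  split.
  - intros [Hf HP].
    assert (Hp : plane (omega s 0 t) (oloid_normal s t) p) by (apply HP; vsimp; ring).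
    destruct (parallel_scal (grad_f lam p) (oloid_normal s t)) as [k Hk].
    { apply oloid_normal_neq0. }
    { apply same_plane_parallel with (1 := HP). }
    rewrite grad_f_E in Hk; unfold oloid_normal in *.
    unfold omega, omega1, omega2, omega3 in Hp.
    pose proof (f_equal px Hk) as Ex; pose proof (f_equal py Hk) as Ey.
    pose proof (f_equal pz Hk) as Ez; vsimp; unfold f_quad in Hf.
    unfold contact_point, kappa1, kappa2, kappa3.
    set (c := cos t) in *; set (S := sin t) in *; set (q := sqrt (1 + 2 * c)) in *.
    (* grad f / 2 has the coordinates (p - c0)_i / a_i, so the factor mu in
       p - c0 = mu (a1 n1, a2 n2, a3 n3) is half of the factor k of the gradient. *)
    set (mu := k / 2).
    assert (Ex' : px p = mu * (1 - lam) * S).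
    { transitivity (2 * (px p / (1 - lam)) / 2 * (1 - lam)); [field; lra|].
      rewrite Ex; unfold mu; field. }
    assert (Ey' : py p = lam - 1 / 2 - mu * (1 - lam + lam ^ 2) * c).
    { transitivity (lam - 1 / 2 + 2 * ((py p - lam + 1 / 2) / (1 - lam + lam ^ 2)) / 2
                                  * (1 - lam + lam ^ 2)); [field; lra|].
      rewrite Ey; unfold mu; field. }
    assert (Ez' : pz p = mu * lam * (s * q)).
    { transitivity (2 * (pz p / lam) / 2 * lam); [field; lra|].
      rewrite Ez; unfold mu; field. }
    clearbody mu; clear Ex Ey Ez Hk HP.
    assert (F1 : (mu * (1 + lam * c)) ^ 2 = 1).
    { rewrite Rpow_mult_distr, <- HD.
      rewrite Ex', Ey', Ez' in Hf; apply Rminus_diag_uniq; rewrite <- Hf; field; lra. }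
    assert (Hh : 1 + lam * c <> 0).
    { intros E; rewrite E in F1; lra. }
    assert (F2 : mu * (1 + lam * c) ^ 2 = 1 + lam * c).
    { pose proof (sin_cos_sq t) as HS; fold S c in HS.
      rewrite <- HD, <- (Rplus_0_r (1 + lam * c)), <- Hp, Ex', Ey', Ez'.
      ring_simplify; rewrite HS; unfold Rdiv; ring. }
    assert (Emu : mu = / (1 + lam * c)).
    { apply (Rmult_eq_reg_r (1 + lam * c)); [rewrite Rinv_l by exact Hh|exact Hh].
      apply (Rmult_eq_reg_r (1 + lam * c)); [|exact Hh].
      rewrite <- F2 at 3; ring_simplify; ring_simplify in F2; lra. }
    split; [exact Hh|].
    apply R3_eq; vsimp; rewrite ?Ex', ?Ey', ?Ez', Emu; field; exact Hh.
  - intros [Hh ->]; set (p := contact_point s lam t).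
    assert (Hp : plane (omega s 0 t) (oloid_normal s t) p).
    { unfold p; rewrite contact_point_on_line by assumption.
      apply line_in_plane; assumption. }
    assert (Hg : grad_f lam p = vscal (2 / (1 + lam * cos t)) (oloid_normal s t)).
    { rewrite grad_f_E; unfold p, contact_point, oloid_normal, kappa1, kappa2, kappa3.
      apply R3_eq; vsimp; field; repeat split; lra. }
    split.
    + apply Rmult_eq_reg_r with ((1 + lam * cos t) ^ 2); [|apply pow_nonzero; exact Hh].
      rewrite Rmult_0_l.
      replace 0 with ((1 + lam * cos t) ^ 2 - (1 + lam * cos t) ^ 2) by ring.
      rewrite <- HD at 2; unfold p, contact_point, kappa1, kappa2, kappa3, f_quad.
      vsimp; field; repeat split; lra.
    + intros v; rewrite Hg, plane_scal.
      * symmetry; apply plane_move; exact Hp.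
      * intros E; apply (Rmult_eq_compat_r (1 + lam * cos t)) in E.
        field_simplify in E; lra.
Qed.

(** For lam = 0 the radius vectors of p and of [omega s 0 t] are unit vectors, and the
    equation of the plane says that their inner product is 1. *)
Lemma contact_point_kA s t p :
  is_sign s -> I1 t ->
  (kA p /\ forall v, tangent_line_kA p v ->
     plane (omega s 0 t) (oloid_normal s t) v)
  <-> p = contact_point s 0 t.
Proof.
  intros Hs Ht; pose proof (sin_cos_sq t) as HS; pose proof (I1_cos t Ht).
  assert (E : contact_point s 0 t = vec (sin t) (- (1 / 2) - cos t) 0).
  { unfold contact_point, kappa1, kappa2, kappa3; apply R3_eq; vsimp; field; lra. }
  rewrite E; clear E.
  unfold oloid_normal, omega, omega1, omega2, omega3; split.
  - intros [[Hp Hz] HP].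
    assert (Hp' : plane (omega s 0 t) (oloid_normal s t) p).
    { apply HP; exists 0; apply R3_eq; vsimp; ring. }
    unfold oloid_normal, omega, omega1, omega2, omega3 in Hp'; vsimp.
    destruct (unit_dot_eq (sin t) (- cos t) (px p) (py p + 1 / 2)) as [E1 E2].
    + rewrite HS; ring.
    + exact Hp.
    + transitivity (sin t ^ 2 + cos t ^ 2 + 0); [rewrite <- Hp', Hz|rewrite HS]; field; lra.
    + apply R3_eq; vsimp; lra.
  - intros ->; unfold kA; vsimp; split; [split; [rewrite HS; field|]; lra|].
    intros v [r ->]; vsimp; field; lra.
Qed.

(** As for the first circle, with the point [omega s 1 t] instead: in the plane
    x = 0 its radius vector is (- cos t, s * sqrt (1 + 2 cos t)) / (1 + cos t), a
    multiple of the last two coordinates of the normal. *)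
Lemma contact_point_kB s t p :
  is_sign s -> I1 t ->
  (kB p /\ forall v, tangent_line_kB p v ->
     plane (omega s 0 t) (oloid_normal s t) v)
  <-> p = contact_point s 1 t.
Proof.
  intros Hs Ht; pose proof (I1_cos t Ht).
  pose proof (line_in_plane s t 1 Hs Ht) as HB.
  pose proof (sqrt_cos_sq t Ht) as Hq; pose proof (is_sign_sq s Hs) as Hs2.
  assert (Hh : 1 + 1 * cos t <> 0) by lra.
  assert (E : contact_point s 1 t = omega s 1 t).
  { rewrite contact_point_on_line by assumption; f_equal; field; lra. }
  rewrite E; split.
  - intros [[Hp Hx] HP].
    assert (Hp' : plane (omega s 0 t) (oloid_normal s t) p).
    { apply HP; exists 0; apply R3_eq; vsimp; ring. }
    apply (plane_move _ _ _ _ HB) in Hp'.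
    unfold oloid_normal, omega, omega1, omega2, omega3 in *; vsimp.
    set (c := cos t) in *; set (q := sqrt (1 + 2 * c)) in *.
    destruct (unit_dot_eq (- c / (1 + c)) (s * q / (1 + c)) (py p - 1 / 2) (pz p))
      as [E1 E2]; [| exact Hp | |].
    + field_simplify_eq; [rewrite Hs2, Hq; ring | lra].
    + apply Rmult_eq_reg_r with (1 + c); [|lra].
      transitivity (1 + c + 0); [rewrite <- Hp', Hx|ring].
      field_simplify_eq; [|lra]. rewrite Hs2, Hq; ring.
    + apply R3_eq; vsimp; [rewrite Hx; ring| |].
      * replace (py p) with (1 / 2 + (py p - 1 / 2)) by ring.
        rewrite <- E1; field; lra.
      * rewrite <- E2; field; lra.
  - intros ->; unfold kB; split.
    + unfold omega, omega1, omega2, omega3; vsimp; split; [|ring].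
      field_simplify_eq; [rewrite Hs2, Hq; ring | lra].
    + intros v [r ->]; apply (plane_move _ _ _ _ HB).
      unfold oloid_normal, omega, omega1, omega2, omega3; vsimp; field; lra.
Qed.

Lemma tangent_to_quadric_iff s t lam P p :
  is_sign s -> I1 t ->
  (forall v, P v <-> plane (omega s 0 t) (oloid_normal s t) v) ->
  tangent_to_quadric lam P p <-> 1 + lam * cos t <> 0 /\ p = contact_point s lam t.
Proof.
  intros Hs Ht HP; unfold tangent_to_quadric, quadric.
  destruct (Req_EM_T lam 0) as [-> | H0]; [|destruct (Req_EM_T lam 1) as [-> | H1]].
  - rewrite <- (contact_point_kA s t p Hs Ht).
    setoid_rewrite HP; split; [intros H; split; [lra|exact H] | intros [_ H]; exact H].
  - pose proof (I1_cos t Ht).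
    rewrite <- (contact_point_kB s t p Hs Ht).
    setoid_rewrite HP; split; [intros H1; split; [lra|exact H1] | intros [_ H1]; exact H1].
  - rewrite <- (contact_point_proper s t lam p Hs Ht H0 H1).
    setoid_rewrite HP; reflexivity.
Qed.

Lemma touching_curve_iff lam p :
  touching_curve lam p <->
  exists s t, is_sign s /\ I1 t /\ 1 + lam * cos t <> 0 /\ p = contact_point s lam t.
Proof.
  split.
  - intros (s & t & P & Hs & Ht & _ & HP & HT).
    rewrite (oloid_tangent_plane_iff s t P Hs Ht) in HP.
    apply (tangent_to_quadric_iff s t lam P p Hs Ht HP) in HT.
    exists s, t; auto.
  - intros (s & t & Hs & Ht & Hh & Hp).
    exists s, t, (plane (omega s 0 t) (oloid_normal s t)).
    split; [exact Hs|]; split; [exact Ht|]; split; [|split].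
    + eexists; rewrite Hp; apply contact_point_on_line; assumption.
    + apply oloid_tangent_plane_iff; [exact Hs|exact Ht|reflexivity].
    + apply (tangent_to_quadric_iff s t); auto; reflexivity.
Qed.

(** * The parametrization *)

Lemma continuous_contact_point s lam t :
  1 + lam * cos t <> 0 -> continuous (contact_point s lam) t.
Proof.
  intros Hh; unfold contact_point, kappa1, kappa2, kappa3, Rdiv.
  assert (C : forall k : R -> R, continuous k t ->
              continuous (fun u => k u * / (1 + lam * cos u)) t).
  { intros k Hk; apply (continuous_mult (K := R_AbsRing)); [exact Hk|].
    apply continuous_Rinv_comp; [|exact Hh].
    apply (ex_derive_continuous (fun u => 1 + lam * cos u)); auto_derive; auto. }
  apply continuous_R3.
  - apply C, (ex_derive_continuous (fun u => (1 - lam) * sin u)); auto_derive; auto.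
  - apply (ex_derive_continuous (fun u =>
      (2 * lam + - (1) + (lam + - (2)) * cos u) * / (2 * (1 + lam * cos u)))).
    auto_derive; lra.
  - apply (continuous_mult (K := R_AbsRing)); [apply continuous_const|].
    apply C, (continuous_mult (K := R_AbsRing)); [apply continuous_const|].
    apply continuous_sqrt_comp.
    apply (ex_derive_continuous (fun u => 1 + 2 * cos u)); auto_derive; auto.
Qed.

Lemma gamma1_E lam t : gamma1 lam t = contact_point 1 lam t.
Proof. apply R3_eq; unfold gamma1, contact_point; vsimp; ring. Qed.

Lemma gamma2_E lam t : gamma2 lam t = contact_point (-1) lam (4 * PI / 3 - t).
Proof. apply R3_eq; unfold gamma2, contact_point; vsimp; ring. Qed.

(** The factor sqrt (1 + 2 cos t) of kappa3 vanishes at t = 2 pi / 3, so the sheets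
    meet there. *)
Lemma contact_point_end lam s s' :
  contact_point s lam (2 * PI / 3) = contact_point s' lam (2 * PI / 3).
Proof.
  unfold contact_point, kappa3; rewrite cos_2PI3'.
  replace (1 + 2 * - (1 / 2)) with 0 by field.
  rewrite sqrt_0; apply R3_eq; vsimp; unfold Rdiv; ring.
Qed.

Lemma continuous_gamma1 lam t :
  1 + lam * cos t <> 0 -> continuous (gamma1 lam) t.
Proof.
  intros H; apply (continuous_ext (contact_point 1 lam)).
  - intros u; symmetry; apply gamma1_E.
  - apply continuous_contact_point, H.
Qed.

Lemma continuous_gamma2 lam t :
  1 + lam * cos (4 * PI / 3 - t) <> 0 -> continuous (gamma2 lam) t.
Proof.
  intros H; apply (continuous_ext (fun u => contact_point (-1) lam (4 * PI / 3 - u))).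
  - intros u; symmetry; apply gamma2_E.
  - apply continuous_comp; [|apply continuous_contact_point, H].
    apply (ex_derive_continuous (fun u => 4 * PI / 3 - u)); auto_derive; auto.
Qed.

(** Where the two arcs meet, gamma is locally one of two continuous functions
    with the same value. *)
Lemma continuous_gamma lam t : gamma_dom lam t -> continuous (gamma lam) t.
Proof.
  intros Ht.
  assert (H1 : t <= 2 * PI / 3 -> continuous (gamma1 lam) t).
  { intros H; apply continuous_gamma1; destruct Ht as [[_ Ht] | [[Ht _] _]]; [exact Ht|lra]. }
  assert (H2 : 2 * PI / 3 <= t -> continuous (gamma2 lam) t).
  { intros H; apply continuous_gamma2; destruct Ht as [[[_ Hu] Ht] | [_ Ht]]; [|exact Ht].
    replace (4 * PI / 3 - t) with t by lra; exact Ht. }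
  destruct (Rtotal_order t (2 * PI / 3)) as [H | [H | H]].
  - apply (continuous_ext_loc _ (gamma1 lam)); [|apply H1; lra].
    apply (filter_imp (fun u => u < 2 * PI / 3)); [|apply open_lt, H].
    intros u Hu; unfold gamma; destruct Rle_dec; [reflexivity|lra].
  - assert (E : gamma1 lam t = gamma2 lam t).
    { rewrite gamma1_E, gamma2_E; replace (4 * PI / 3 - t) with t by lra.
      rewrite H; apply contact_point_end. }
    intros P HP; unfold gamma in HP; destruct Rle_dec as [_|]; [|lra].
    pose proof (H1 ltac:(lra) P HP) as K1; rewrite E in HP.
    pose proof (H2 ltac:(lra) P HP) as K2.
    unfold filtermap in *; generalize (filter_and _ _ K1 K2); apply filter_imp.
    intros u [Hu1 Hu2]; unfold gamma; destruct Rle_dec; assumption.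
  - apply (continuous_ext_loc _ (gamma2 lam)); [|apply H2; lra].
    apply (filter_imp (fun u => 2 * PI / 3 < u)); [|apply open_gt, H].
    intros u Hu; unfold gamma; destruct Rle_dec; [lra|reflexivity].
Qed.

Theorem corollary1 (lam : R) :
  parametrizes (gamma_dom lam) (gamma lam) (touching_curve lam).
Proof.
  split; [apply continuous_on_forall; intros t; apply continuous_gamma|].
  intros p; rewrite touching_curve_iff; split.
  - intros (s & t & Hs & Ht & Hh & ->).
    (* The end t = 2 pi / 3 of the second arc is attained by the first arc only,
       since I2 is open on that side. *)
    assert (D : s = 1 \/ t = 2 * PI / 3 \/ s = -1 /\ t < 2 * PI / 3).
    { destruct Hs; [auto|]; destruct (Req_dec t (2 * PI / 3)); [auto|].
      unfold I1 in Ht; right; right; split; [assumption|lra]. }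
    assert (D1 : contact_point s lam t = contact_point 1 lam t \/
                 s = -1 /\ t < 2 * PI / 3).
    { destruct D as [-> | [-> | D]]; [auto | left; apply contact_point_end | auto]. }
    destruct D1 as [-> | [-> Ht']].
    + exists t; split; [left; auto|].
      unfold gamma; destruct Rle_dec; [apply gamma1_E | unfold I1 in Ht; lra].
    + exists (4 * PI / 3 - t).
      assert (E : 4 * PI / 3 - (4 * PI / 3 - t) = t) by ring.
      split; [right; rewrite E; unfold I1, I2 in *; split; [lra|exact Hh]|].
      unfold gamma; destruct Rle_dec; [lra|].
      rewrite gamma2_E, E; reflexivity.
  - intros (t & Ht & <-); unfold gamma.
    destruct Ht as [[Ht Hh] | [Ht Hh]]; unfold I1, I2 in *; destruct Rle_dec; try lra.
    + exists 1, t; split; [left; reflexivity|]; rewrite gamma1_E; auto.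
    + exists (-1), (4 * PI / 3 - t); split; [right; reflexivity|].
      rewrite gamma2_E; split; [unfold I1; lra|auto].
Qed.
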